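(* Let $d\ge 2$ and $n\ge 1$ be integers and let $p'\in[0,n+1]$. Then the De Bruijn digraph $B(d,n)$ is isomorphic to the digraph $H(d^{p'},d^{n+1-p'},d)$ if and only if $\gcd(p',n+1)=1$.
   Context: For integers $a\le b$, $[a,b]=\{c\in\mathbb{Z}: a\le c\le b\}$. Digraphs may have loops and multiple arcs; an isomorphism of digraphs is a bijection of vertices preserving arc multiplicities. For positive integers $p,q$, every $a\in[0,pq-1]$ is written uniquely as $a=iq+j$ with $i\in[0,p-1]$, $j\in[0,q-1]$, denoted $a=(i,j)_{p,q}$. For positive integers $p,q$ and a divisor $d>1$ of $pq$, the digraph $H(p,q,d)$ has vertex set $[0,pq/d-1]$, where vertex $k$ represents the block $[kd,kd+d-1]$; for each $i\in[0,p-1]$, $j\in[0,q-1]$ there is one arc from the vertex whose block contains $(i,j)_{p,q}=iq+j$ to the vertex whose block contains $(q-1-j,p-1-i)_{q,p}=(q-1-j)p+(p-1-i)$ (arcs counted with multiplicity). The line digraph $L(G)$ of a digraph $G$ has the arcs of $G$ as vertices, with an arc from $(u,v)$ to $(v,w)$ whenever these are arcs of $G$. $K_d^+$ is the complete digraph on $d$ vertices with a loop at every vertex (one arc from each vertex to each vertex, including itself), and the De Bruijn digraph is $B(d,n)=L^n(K_d^+)$, the $n$-th iterated line digraph; equivalently its vertices are the words $x_1\cdots x_n$ over a $d$-letter alphabet with arcs $x_1x_2\cdots x_n\to x_2\cdots x_n y$ for every letter $y$. *)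

(* Defs.v *)
From mathcomp Require Import all_boot.

Set Implicit Arguments.
Unset Strict Implicit.
Unset Printing Implicit Defensive.

(* A finite digraph, loops and multiple arcs allowed: [mult u v] is the number
   of arcs from [u] to [v]. *)
Record digraph := Digraph { vertex : finType; mult : vertex -> vertex -> nat }.

Definition digraph_iso (G K : digraph) : Prop :=
  exists2 f : vertex G -> vertex K,
    bijective f & forall u v, mult (f u) (f v) = mult u v.

(* [a] lies in the interval [kd, kd + d - 1]. *)
Definition in_block (d k a : nat) : bool := k * d <= a < k * d + d.

(* Meant for [0 < p], [0 < q], [1 < d] and [d %| p * q]. *)
Definition Hdigraph (p q d : nat) : digraph :=
  @Digraph 'I_(p * q %/ d) (fun u v =>
    #|[set ij : 'I_p * 'I_q |
        in_block d u (ij.1 * q + ij.2) &&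
        in_block d v ((q - 1 - ij.2) * p + (p - 1 - ij.1))]|).

(* The De Bruijn digraph on words of length [n]; each letter [y] contributes
   one arc x_1 ... x_n -> x_2 ... x_n y. *)
Definition debruijn (d n : nat) : digraph :=
  @Digraph (n.-tuple 'I_d) (fun u v =>
    #|[set y : 'I_d | v == rcons (behead u) y :> seq 'I_d]|).

Definition complete_loops (d : nat) : digraph :=
  @Digraph 'I_d (fun _ _ => 1).

(* The arcs from [u] to [v] are labelled by 'I_(mult u v). *)
Definition arc (G : digraph) : finType :=
  {uv : vertex G * vertex G & 'I_(mult uv.1 uv.2)}.

Definition line_digraph (G : digraph) : digraph :=
  @Digraph (arc G) (fun a b => (tag a).2 == (tag b).1 : nat).

Lemma debruijn_mult_le1 d n (u v : vertex (debruijn d n)) : mult u v <= 1.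
Proof.
rewrite /=; apply/card_le1_eqP=> x y; rewrite !inE => /eqP -> /eqP.
by move/rcons_inj=> [].
Qed.

Lemma debruijn_multE d n (u v : vertex (debruijn d n.+1)) :
  mult u v = (behead u == take n v :> seq 'I_d).
Proof.
have := debruijn_mult_le1 u v; case: eqP => [E|nE] le1; last first.
  apply/eqP; rewrite cards_eq0; apply/eqP/setP=> y; rewrite !inE.
  apply/negP=> /eqP E; apply: nE; rewrite E -cats1 take_size_cat //.
  by rewrite size_behead size_tuple.
apply/eqP; rewrite eqn_leq le1 /= card_gt0; apply/set0Pn.
exists (tnth v ord_max); rewrite inE E.
by rewrite (tnth_nth (tnth v ord_max)) -take_nth ?size_tuple // take_oversize ?size_tuple.
Qed.

Lemma belast_take_size (T : Type) (x : T) s :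
  belast x s = take (size s) (x :: s).
Proof. by elim: s x => //= y s IH x; rewrite IH; case: s {IH}. Qed.

Lemma debruijn_line_step d n (G : digraph) :
  digraph_iso (debruijn d n.+1) G ->
  digraph_iso (debruijn d n.+2) (line_digraph G).
Proof.
case=> f [g fK gK] fm.
pose P (w : n.+2.-tuple 'I_d) : n.+1.-tuple 'I_d := [tuple of belast (thead w) (behead w)].
pose S (w : n.+2.-tuple 'I_d) : n.+1.-tuple 'I_d := [tuple of behead w].
have PE w : P w = take n.+1 w :> seq _.
  case/tupleP: w => x w; rewrite /P /= theadE.
  by rewrite belast_take_size size_tuple.
have m1 w : mult (f (P w)) (f (S w)) = 1.
  rewrite fm debruijn_multE PE /S; case/tupleP: w => x w /=.
  by rewrite eqxx.
have m0 w : 0 < mult (f (P w)) (f (S w)) by rewrite m1.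
pose F (w : n.+2.-tuple 'I_d) : arc G :=
  existT (fun uv : vertex G * vertex G => 'I_(mult uv.1 uv.2))
    (f (P w), f (S w)) (Ordinal (m0 w)).
pose Q (a : arc G) : n.+2.-tuple 'I_d :=
  [tuple of thead (g (tag a).1) :: g (tag a).2].
have FK : cancel F Q.
  move=> w; apply: val_inj; rewrite /= !fK /=.
  case/tupleP: w => x w /=; case/tupleP: w => y w /=.
  by rewrite /P /thead /tnth /=.
have QK : cancel Q F.
  case=> [[a b] k].
  have k1 : 0 < mult a b by apply: leq_ltn_trans (ltn_ord k).
  have E : behead (g a) = take n (g b) :> seq _.
    apply/eqP; move: k1; rewrite -(gK a) -(gK b) fm debruijn_multE !gK.
    by case: eqP.
  have le1 : mult a b <= 1.
    by rewrite -(gK a) -(gK b) fm debruijn_mult_le1.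
  have EP : f (P (Q (existT _ (a, b) k))) = a.
    rewrite -[RHS]gK; congr f; apply: val_inj; apply: etrans (PE _) _.
    rewrite /= -E.
    by case/tupleP: (g a).
  have ES : f (S (Q (existT _ (a, b) k))) = b.
    by rewrite -[RHS]gK; congr f; apply: val_inj.
  rewrite /F; move: (m0 _); rewrite EP ES => h; congr existT.
  apply: val_inj => /=.
  by have /leq_trans/(_ le1) := ltn_ord k; rewrite ltnS leqn0 => /eqP.
exists F; first by exists Q.
move=> u v; rewrite [RHS]debruijn_multE /= (can_eq fK) -val_eqE /= -/(S u) -/(P v).
by rewrite -PE.
Qed.

(* The word digraph on words of length [n + 1] is the [n]-th iterated line
   digraph of the complete digraph with loops. *)
Lemma debruijn_iter_line d n :
  digraph_iso (debruijn d n.+1) (iter n line_digraph (complete_loops d)).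
Proof.
elim: n => [|n IH]; last exact: debruijn_line_step.
exists (fun w : 1.-tuple 'I_d => thead w).
  exists (fun x => [tuple x]) => [w|x]; last by [].
  by case/tupleP: w => x w; rewrite (tuple0 w).
move=> u v; rewrite debruijn_multE take0.
by case/tupleP: u => x u; rewrite (tuple0 u).
Qed.

(* Main.v *)
(* Write N = n + 1 and read the numbers below d^N as words of N base-d digits.
   An arc of H(d^p, d^(N-p), d) rotates the positions of such a word by p and
   complements every digit, and a vertex is a word with position 0 erased. So
   only a digit moving into position p is free. If gcd(p, N) = 1, listing the
   positions as p, 2p, ..., np (mod N) and complementing every other digit gives
   the De Bruijn shift. If g = gcd(p, N) > 1, the digits in the positions
   congruent to 1 modulo g never meet position 0, so they are determined along a
   walk by its start, whereas in B(d, n) any two vertices are joined by a walk of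
   length exactly n. *)
Require Import Defs.
From mathcomp Require Import all_boot zify.

(** * Base-[d] digits of natural numbers *)

(** Positions are counted from the least significant digit, so position 0 is the one lost in passing
    from [a] to its block [a %/ d]. *)
Definition digit (d k a : nat) : nat := a %/ d ^ k %% d.

Lemma complK d x : x < d -> d - 1 - (d - 1 - x) = x.
Proof. by lia. Qed.

Lemma digitS d k a : digit d k.+1 a = digit d k (a %/ d).
Proof. by rewrite /digit expnS divnMA. Qed.

Lemma ltn_digit d k a : 0 < d -> digit d k a < d.
Proof. exact: ltn_pmod. Qed.

Lemma digit_lo d m k h l : k < m -> digit d k (h * d ^ m + l) = digit d k l.
Proof.
case: d => [|d]; first by move=> km; rewrite exp0n ?muln0 //; lia.
move=> km; rewrite /digit -(subnK km) addnS -addSn expnD expnS.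
rewrite mulnA divnMDl ?expn_gt0 // (mulnC d.+1) mulnA.
by rewrite modnMDl.
Qed.

Lemma digit_hi d m k h l : l < d ^ m -> digit d (m + k) (h * d ^ m + l) = digit d k h.
Proof.
move=> lt; have m0 : 0 < d ^ m by apply: leq_ltn_trans lt.
by rewrite /digit expnD divnMA divnMDl // (divn_small lt) addn0.
Qed.

(** All [M] digits of [d ^ M - 1] equal [d - 1], so the subtraction never borrows. *)
Lemma digit_compl d M k a : k < M -> a < d ^ M ->
  digit d k (d ^ M - 1 - a) = d - 1 - digit d k a.
Proof.
elim: M k a => // M IH k a kM; case: (posnP d) => [->|d0]; first by rewrite exp0n.
rewrite expnSr => aM.
have hM : a %/ d < d ^ M by rewrite ltn_divLR.
have lM : a %% d < d by rewrite ltn_pmod.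
have -> : d ^ M * d - 1 - a = (d ^ M - 1 - a %/ d) * d + (d - 1 - a %% d).
  rewrite {1}(divn_eq a d); move: hM lM; move: (a %/ d) (a %% d) (d ^ M) => h l e.
  move=> he ld; rewrite !mulnBl mul1n.
  have : h.+1 * d <= e * d by rewrite leq_mul2r he orbT.
  rewrite mulSn; lia.
case: k kM => [|k] kM.
  by rewrite /digit expn0 !divn1 modnMDl modn_small //; lia.
by rewrite !digitS divnMDl // (@divn_small (_ - _)) ?addn0 ?IH //; lia.
Qed.

Lemma digit_inj d M a b : a < d ^ M -> b < d ^ M ->
  (forall k, k < M -> digit d k a = digit d k b) -> a = b.
Proof.
elim: M a b => [|M IH] a b; first by rewrite expn0 !ltnS !leqn0 => /eqP-> /eqP->.
case: (posnP d) => [->|d0]; first by rewrite exp0n.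
rewrite expnSr => aM bM E; rewrite (divn_eq a d) (divn_eq b d).
have := E 0 isT; rewrite /digit expn0 !divn1 => ->.
by rewrite (IH (a %/ d) (b %/ d)) ?ltn_divLR // => k kM; rewrite -!digitS E.
Qed.

(** * Arcs of the digraph H as rotations of digits *)

Lemma in_blockE d k a : 0 < d -> in_block d k a = (a %/ d == k).
Proof.
move=> d0.
by rewrite /in_block -leq_divRL // addnC -mulSn -ltn_divLR // ltnS eqn_leq andbC.
Qed.

(** The image of [i * d ^ (N - p) + j] is [d ^ N - 1] minus [j * d ^ p + i]. Exchanging the digit
    strings of [i] and [j] rotates positions by [p], and the subtraction complements each digit. *)
Lemma digit_swap d N p k i j : 0 < d -> p <= N -> k < N ->
  i < d ^ p -> j < d ^ (N - p) ->
  digit d ((k + p) %% N) ((d ^ (N - p) - 1 - j) * d ^ p + (d ^ p - 1 - i)) =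
  d - 1 - digit d k (i * d ^ (N - p) + j).
Proof.
move=> d0 pN kN ip jq.
have -> : (d ^ (N - p) - 1 - j) * d ^ p + (d ^ p - 1 - i) =
          d ^ N - 1 - (j * d ^ p + i).
  rewrite -{2}(subnK pN) expnD; move: (d ^ (N - p)) (d ^ p) ip jq => e f ip jq.
  have : j.+1 * f <= e * f by rewrite leq_mul2r jq orbT.
  by rewrite mulSn !mulnBl mul1n; lia.
have lt : j * d ^ p + i < d ^ N.
  rewrite -(subnK pN) expnD.
  apply: (@leq_trans (j.+1 * d ^ p)); last by rewrite leq_mul2r jq orbT.
  by rewrite mulSn addnC ltn_add2r.
rewrite digit_compl ?ltn_pmod //; last by lia.
congr (_ - _); case: (ltnP k (N - p)) => kq.
  by rewrite modn_small; [rewrite addnC digit_hi // digit_lo | lia].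
have -> : (k + p) %% N = k - (N - p).
  have -> : k + p = k - (N - p) + N by lia.
  by rewrite modnDr modn_small //; apply: leq_ltn_trans (leq_subr _ _) kN.
by rewrite digit_lo; [rewrite -{2}(subnKC kq) digit_hi | lia].
Qed.

Lemma swap_lt d N p i j : 0 < d -> p <= N -> i < d ^ p -> j < d ^ (N - p) ->
  (d ^ (N - p) - 1 - j) * d ^ p + (d ^ p - 1 - i) < d ^ N.
Proof.
move=> d0 pN ip jq; rewrite -{2}(subnK pN) expnD.
apply: (@leq_trans ((d ^ (N - p) - 1 - j).+1 * d ^ p)).
  by rewrite mulSn addnC ltn_add2r; lia.
by rewrite leq_mul2r; lia.
Qed.

Lemma order_Hdigraph d N p : 0 < d -> 0 < N -> p <= N ->
  d ^ p * d ^ (N - p) %/ d = d ^ N.-1.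
Proof. by case: N => // N d0 _ pN; rewrite -expnD subnKC // expnS mulKn. Qed.

(* Here [u] and [v] are vertices: position [k.+1] of a block is position [k] of
   its vertex number. *)
Definition rotated_digits (d N p u v : nat) : bool :=
  [forall k : 'I_N, (0 < k) && (0 < (k + p) %% N) ==>
     (digit d ((k + p) %% N).-1 v == d - 1 - digit d k.-1 u)].

Lemma rotated_digitsP d N p u v :
  reflect (forall k, k < N -> 0 < k -> 0 < (k + p) %% N ->
             digit d ((k + p) %% N).-1 v = d - 1 - digit d k.-1 u)
          (rotated_digits d N p u v).
Proof.
apply: (iffP forallP) => [H k kN k0 kp0|H k].
  by have := H (Ordinal kN); rewrite /= k0 kp0 => /eqP.
by apply/implyP => /andP[k0 kp0]; apply/eqP/H.
Qed.

(** This implication includes [p = 0] and [p = N], which the non-coprime case requires. *)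
Lemma Hmult_rotated d N p (u v : vertex (Hdigraph (d ^ p) (d ^ (N - p)) d)) :
  0 < d -> p <= N -> 0 < mult u v -> rotated_digits d N p u v.
Proof.
move=> d0 pN; rewrite card_gt0 => /set0Pn[[i j]]; rewrite inE !in_blockE //=.
case/andP=> /eqP <- /eqP <-; apply/rotated_digitsP => k kN k0 kp0.
rewrite -!digitS !prednK //.
exact: digit_swap.
Qed.

(** For [0 < p < N] the erased digit of the source moves to position [p], which the target vertex
    retains; hence [v] determines the arc out of [u]. *)
Lemma Hmult_rotatedE d N p (u v : vertex (Hdigraph (d ^ p) (d ^ (N - p)) d)) :
  0 < d -> 0 < p < N -> mult u v = rotated_digits d N p u v.
Proof.
move=> d0 /andP[p0 pN].
have ppN : (0 + p) %% N = p by rewrite modn_small.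
have digitp x : digit d p x = digit d p.-1 (x %/ d) by rewrite -digitS prednK.
have ltN w : w < d ^ N -> w %/ d < d ^ N.-1.
  by rewrite ltn_divLR // -expnSr prednK //; lia.
have ltv (w : vertex (Hdigraph (d ^ p) (d ^ (N - p)) d)) : w < d ^ N.-1.
  by apply: leq_trans (ltn_ord w) _; rewrite order_Hdigraph //; lia.
have le1 : mult u v <= 1.
  apply/card_le1_eqP => -[i j] [i' j']; rewrite !inE !in_blockE //=.
  case/andP=> /eqP iju /eqP ijv /andP[/eqP iju' /eqP ijv'].
  have D0 : digit d 0 (i * d ^ (N - p) + j) = digit d 0 (i' * d ^ (N - p) + j').
    have := @digit_swap d N p 0 i j d0 (ltnW pN) (ltn_trans p0 pN) (ltn_ord _) (ltn_ord _).
    have := @digit_swap d N p 0 i' j' d0 (ltnW pN) (ltn_trans p0 pN) (ltn_ord _) (ltn_ord _).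
    rewrite ppN !digitp ijv ijv' => -> /esym/(congr1 (subn (d - 1))).
    by rewrite !complK ?ltn_digit.
  have E : i * d ^ (N - p) + j = i' * d ^ (N - p) + j'.
    rewrite (divn_eq (i * _ + _) d) (divn_eq (i' * _ + _) d) iju iju'.
    by move: D0; rewrite /digit !expn0 !divn1 => ->.
  have q0 : 0 < d ^ (N - p) by rewrite expn_gt0 d0.
  have := congr1 (divn^~ (d ^ (N - p))) E; have := congr1 (modn^~ (d ^ (N - p))) E.
  rewrite /= !modnMDl !divnMDl // !modn_small // !divn_small // !addn0 => jj ii.
  by congr pair; apply: val_inj.
suff -> : rotated_digits d N p u v = (0 < mult u v) by case: (mult u v) le1 => [|[|]].
apply/idP/idP => [/rotated_digitsP R|]; last exact/Hmult_rotated/ltnW.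
(* [a] is the only candidate in block [u]: its last digit [x] must be the complement of the digit of
   [v] at position [p]. *)
set x := d - 1 - digit d p.-1 v; pose a := u * d + x.
have xd : x < d by rewrite /x; lia.
have au : a %/ d = u by rewrite divnMDl // (divn_small xd) addn0.
have a0 : digit d 0 a = x by rewrite /digit expn0 divn1 modnMDl modn_small.
have aN : a < d ^ N.
  rewrite -[N]prednK ?expnSr; last by lia.
  by rewrite -ltn_divLR // au ltv.
have q0 : 0 < d ^ (N - p) by rewrite expn_gt0 d0.
have ip : a %/ d ^ (N - p) < d ^ p by rewrite ltn_divLR // -expnD subnKC // ltnW.
have jq : a %% d ^ (N - p) < d ^ (N - p) by rewrite ltn_mod.
rewrite card_gt0; apply/set0Pn; exists (Ordinal ip, Ordinal jq).
rewrite inE !in_blockE //= -divn_eq au eqxx /=; apply/eqP.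
apply: (@digit_inj d N.-1) => [||k kN]; [exact/ltN/swap_lt/jq/ip/ltnW | exact: ltv |].
have kN' : k.+1 < N by lia.
(* [l] is the position that rotates to [k.+1]. The choice of [x] settles [l = 0], and [R] settles
   the others. *)
pose l := (k.+1 + (N - p)) %% N.
have lN : l < N by rewrite ltn_pmod //; lia.
have lp : (l + p) %% N = k.+1.
  by rewrite /l modnDml -addnA subnK 1?ltnW // modnDr modn_small.
rewrite -digitS -lp (digit_swap _ _ _ _ _ _ d0 (ltnW pN)) // -divn_eq.
case: (posnP l) lp => [->|l0] lp.
  have -> : k = p.-1 by rewrite -[k]/(k.+1.-1) -lp ppN.
  by rewrite a0 complK ?ltn_digit.
rewrite -(prednK l0) digitS au.
by rewrite -[k]/(k.+1.-1) -lp R // lp.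
Qed.

(** * Walks in the De Bruijn digraph *)

(** Appending the letters of [v] one at a time to [u] is a walk of length [n.+1] from [u] to [v];
    [P m] is an invariant carried along to step [m]. *)
Lemma debruijn_walk d n (P : nat -> vertex (debruijn d n.+1) -> Prop) u v :
  P 0 u -> (forall m x y, 0 < mult x y -> P m x -> P m.+1 y) -> P n.+1 v.
Proof.
move=> P0 PS.
pose shift (w : n.+1.-tuple 'I_d) y : n.+1.-tuple 'I_d :=
  [tuple of behead (rcons w y)].
have walk l : forall m w, P m w -> P (m + size l) (foldl shift w l).
  elim: l => [|y l IH] m w Pw /=; first by rewrite addn0.
  rewrite addnS -addSn; apply: IH; apply: PS Pw.
  rewrite card_gt0; apply/set0Pn; exists y; rewrite inE.
  by case/tupleP: w.
have shiftE l : forall w, foldl shift w l = drop (size l) (w ++ l) :> seq _.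
  elim: l => [|y l IH] w /=; first by rewrite cats0 drop0.
  by rewrite IH; case/tupleP: w => x w /=; rewrite cat_rcons.
have := walk v _ _ P0; rewrite size_tuple.
suff -> : foldl shift u v = v by [].
by apply: val_inj; rewrite /= shiftE size_tuple drop_size_cat ?size_tuple.
Qed.

(** * The coprime case: alternate complements and multiples of [p] *)

Definition flip (d : nat) (b : bool) (x : nat) : nat := if b then d - 1 - x else x.

Lemma flip_lt d b x : x < d -> flip d b x < d.
Proof. by rewrite /flip; case: b; lia. Qed.

Lemma flipK d b x : x < d -> flip d b (flip d b x) = x.
Proof. by rewrite /flip; case: b => //; exact: complK. Qed.

Lemma flipN d b x : x < d -> flip d (~~ b) x = d - 1 - flip d b x.
Proof. by rewrite /flip; case: b => //= xd; rewrite complK. Qed.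

(** Complementing letters of odd index only turns the complementing rule of H into plain equality of
    consecutive letters. *)
Lemma eq_flip d b x y : x < d -> y < d ->
  (flip d b x == flip d (~~ b) y) = (y == d - 1 - x).
Proof.
by move=> xd yd; rewrite /flip; apply/eqP/eqP; case: b => /=; lia.
Qed.

Lemma coprime_modn_gt0 N p m : coprime p N -> 0 < m < N -> 0 < m * p %% N.
Proof.
move=> cop /andP[m0 mN]; rewrite lt0n; apply/negP => /eqP/eqP.
by rewrite -/(dvdn N _) Gauss_dvdl 1?coprime_sym // gtnNdvd.
Qed.

(** A Bezout inverse [r] of [p] modulo [N] gives [m] as [k * r] reduced modulo [N]. *)
Lemma coprime_modn_surj N p k : coprime p N -> 0 < k < N ->
  exists2 m, 0 < m < N & m * p %% N = k.
Proof.
move=> cop /andP[k0 kN].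
case: (posnP p) cop => [->|p0 cop]; first by rewrite /coprime gcd0n => /eqP N1; lia.
case: (egcdnP N p0) => r s E _; move: E; rewrite (eqP cop) => E.
have mp : (k * r %% N) * p %% N = k.
  by rewrite modnMml -mulnA E mulnDr muln1 mulnA modnMDl modn_small.
exists (k * r %% N) => //; rewrite ltn_pmod ?(leq_ltn_trans _ kN) // andbT lt0n.
by apply: contraTneq k0 => m0; rewrite -mp m0 mul0n mod0n.
Qed.

Lemma debruijn_iso_coprime d n p : 1 < d -> p <= n.+2 -> coprime p n.+2 ->
  digraph_iso (debruijn d n.+1) (Hdigraph (d ^ p) (d ^ (n.+2 - p)) d).
Proof.
move=> d1 pN cop; have d0 := ltnW d1; set H := Hdigraph _ _ _.
have p0N : 0 < p < n.+2.
  apply/andP; split; last rewrite ltn_neqAle pN andbT.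
    by rewrite lt0n; apply: contraTneq cop => ->; rewrite /coprime gcd0n.
  by apply: contraTneq cop => ->; rewrite /coprime gcdnn.
have ordK : d ^ p * d ^ (n.+2 - p) %/ d = d ^ n.+1 by exact: order_Hdigraph.
pose letter m (v : vertex H) := flip d (odd m) (digit d (m * p %% n.+2).-1 v).
have letter_lt m v : letter m v < d by rewrite flip_lt ?ltn_digit.
(* The indices decrease from [n.+1] to 1: an arc of H carries letter [m] to letter [m.+1], while the
   De Bruijn shift moves letters to the left. The new last letter is letter 1, the free digit at
   position [p]. *)
pose g (v : vertex H) : vertex (debruijn d n.+1) :=
  [tuple Ordinal (letter_lt (n.+1 - i) v) | i < n.+1].
have nth_g v i x : i < n.+1 -> nth x (map val (g v)) i = letter (n.+1 - i) v.
  move=> i_n; rewrite (nth_map (Ordinal d0)) ?size_tuple //.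
  by rewrite -[i]/(val (Ordinal i_n)) -tnth_nth tnth_mktuple.
have size_g v : size (map val (g v)) = n.+1 by rewrite size_map (size_tuple (g v)).
have inj_g : injective g.
  move=> u v guv; apply: val_inj.
  apply: (@digit_inj d n.+1) => [||k kn]; try by rewrite -ordK ltn_ord.
  have [m /andP[m0 mN] mk] := coprime_modn_surj _ p k.+1 cop kn.
  have i_n : n.+1 - m < n.+1 by lia.
  have mK : n.+1 - (n.+1 - m) = m by lia.
  have := nth_g u _ 0 i_n; rewrite guv nth_g // mK /letter mk /=.
  move/(congr1 (flip d (odd m))); rewrite !flipK ?ltn_digit //.
have [h hK gK] : bijective g.
  by apply: inj_card_bij inj_g _; rewrite card_tuple !card_ord ordK.
have gm u v : mult (g u) (g v) = mult u v.
  rewrite debruijn_multE Hmult_rotatedE //; congr nat_of_bool.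
  have arcE m : (letter m u == letter m.+1 v) =
      (digit d (m.+1 * p %% n.+2).-1 v == d - 1 - digit d (m * p %% n.+2).-1 u).
    by rewrite eq_flip ?ltn_digit.
  have behead_take : (behead (g u) == take n (g v) :> seq 'I_d) =
      [forall m : 'I_n, letter m.+1 u == letter m.+2 v].
    rewrite -(inj_eq (inj_map val_inj)) map_take -behead_map.
    apply/eqP/forallP => [E m|E].
      have m_n : n - m.+1 < n by case: m => m /=; lia.
      have := congr1 (nth 0 ^~ (n - m.+1)) E.
      rewrite nth_behead nth_take // !nth_g; try by [lia | case: m m_n => m /=; lia].
      have -> : n.+1 - (n - m.+1).+1 = m.+1 by case: m m_n => m /=; lia.
      have -> : n.+1 - (n - m.+1) = m.+2 by case: m m_n => m /=; lia.
      by move->.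
    apply: (@eq_from_nth _ 0).
      by rewrite size_behead size_take !size_g ltnSn.
    move=> i; rewrite size_behead size_g => i_n.
    have m_n : n - i.+1 < n by lia.
    have := E (Ordinal m_n); rewrite /= nth_behead nth_take // !nth_g //; last by lia.
    have -> : (n - i.+1).+2 = n.+1 - i by lia.
    have -> : (n - i.+1).+1 = n.+1 - i.+1 by lia.
    by move/eqP.
  (* Positions [k] with [k] and [k + p] both nonzero modulo [n.+2] are the multiples [m * p] with
     [0 < m < n.+1]; [m = n.+1] is the one sent to position 0. *)
  rewrite behead_take; apply/forallP/rotated_digitsP => [E k kN k0 kp0|R m].
    have [m /andP[m0 mN] mk] := coprime_modn_surj n.+2 p k cop (introT andP (conj k0 kN)).
    have mk' : m.+1 * p %% n.+2 = (k + p) %% n.+2.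
      by rewrite mulSn addnC -mk modnDml.
    have m_n : m.-1 < n.
      have : m != n.+1.
        by apply: contraTneq kp0 => E'; rewrite -mk' E' modnMr.
      by lia.
    have := E (Ordinal m_n); rewrite /= prednK // arcE.
    by rewrite mk mk' => /eqP.
  have mk' : m.+2 * p %% n.+2 = (m.+1 * p %% n.+2 + p) %% n.+2.
    by rewrite modnDml addnC -mulSn.
  have m_n := ltn_ord m.
  by rewrite arcE mk' R ?ltn_pmod // -?mk' coprime_modn_gt0 //=; lia.
exists h; first by exists g.
by move=> u v; rewrite -gm !gK.
Qed.

(** * The non-coprime case *)

Lemma debruijn_niso_not_coprime d n p : 1 < d -> p <= n.+2 -> ~~ coprime p n.+2 ->
  ~ digraph_iso (debruijn d n.+1) (Hdigraph (d ^ p) (d ^ (n.+2 - p)) d).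
Proof.
move=> d1 pN; set g := gcdn p n.+2 => ncop; have d0 := ltnW d1.
have g1 : 1 < g by rewrite ltn_neqAle eq_sym ncop gcdn_gt0 orbT.
have gN : g %| n.+2 by exact: dvdn_gcdr.
have gp : g %| p by exact: dvdn_gcdl.
have ordK : d ^ p * d ^ (n.+2 - p) %/ d = d ^ n.+1 by exact: order_Hdigraph.
have lt0 : 0 < d ^ p * d ^ (n.+2 - p) %/ d by rewrite ordK expn_gt0 d0.
have lt1 : 1 < d ^ p * d ^ (n.+2 - p) %/ d by rewrite ordK -{1}(expn0 d) ltn_exp2l.
case=> f [h fK hK] fm.
(* Along a walk from vertex 0 of H, the digits at positions congruent to 1 modulo [g] start as 0 and
   are complemented at each step. *)
pose P m w := forall t, t < n.+2 -> t = 1 %[mod g] ->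
  digit d t.-1 (f w) = flip d (odd m) 0.
have Pn w : P n.+1 w.
  apply: (@debruijn_walk _ _ P (h (Ordinal lt0))) => [t _ _|m x y].
    by rewrite hK /digit div0n mod0n.
  rewrite -fm => /(Hmult_rotated _ _ _ _ _ d0 pN) /rotated_digitsP R Px t tN t1.
  (* [k] is the position that rotates to [t]. As [g] divides [p] and [n.+2], it is again congruent
     to 1, hence nonzero. *)
  pose k := (t + (n.+2 - p)) %% n.+2.
  have nz s : s = 1 %[mod g] -> 0 < s.
    by case: s => // /esym; rewrite mod0n modn_small.
  have kN : k < n.+2 by rewrite ltn_pmod.
  have k1 : k = 1 %[mod g].
    rewrite /k modn_dvdm // -t1 -modnDmr.
    have /eqP -> : g %| n.+2 - p by rewrite dvdn_sub.
    by rewrite addn0.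
  have kp : (k + p) %% n.+2 = t.
    by rewrite modnDml -addnA subnK // modnDr modn_small.
  rewrite -kp R ?kp ?(nz t) ?(nz k) // Px //= flipN //.
(* All vertices would share the digit at position 1, the last digit of the vertex number, but
   vertices 0 and 1 differ there. *)
have := Pn (h (Ordinal lt0)) 1 isT erefl; have := Pn (h (Ordinal lt1)) 1 isT erefl.
by rewrite !hK /digit /= expn0 !divn1 mod0n modn_small // => <-.
Qed.

Theorem theorem2p3 (d n p' : nat) (hd : 2 <= d) (hn : 1 <= n)
    (hp' : p' <= n + 1) :
  digraph_iso (debruijn d n) (Hdigraph (d ^ p') (d ^ (n + 1 - p')) d) <->
  gcdn p' (n + 1) = 1.
Proof.
case: n hn hp' => // n _; rewrite addn1 => pN; split=> [iso|/eqP cop].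
  by apply/eqP; apply: contraPT iso => ncop; apply: debruijn_niso_not_coprime.
exact: debruijn_iso_coprime.
Qed.
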